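(* For every prime power $q\ge 4$ there exists a set $\mathcal X$ of $q^2-q+1$ points of $\mathrm{AG}(6,q)$ that is both a $5$-general set and a $(6,4)$-set, and that is transitive: the group of projectivities of $\mathrm{PG}(6,q)$ stabilizing $\mathcal X$ and the hyperplane at infinity acts transitively on the points of $\mathcal X$.
   Context: For integers $r,s$, an $(r,s)$-set of $\mathrm{PG}(n,q)$ is a set $\mathcal X$ of points such that: (i) every $s$-dimensional projective subspace contains at most $r$ points of $\mathcal X$; (ii) $\mathcal X$ spans $\mathrm{PG}(n,q)$; (iii) some $(s+1)$-dimensional projective subspace contains $r+2$ points of $\mathcal X$. A $k$-general set is a $(k-1,k-2)$-set (so a $5$-general set is a $(4,3)$-set). A set of points of $\mathrm{AG}(n,q)$ is called an $(r,s)$-set (resp. $k$-general set) of $\mathrm{AG}(n,q)$ if, regarded as a subset of $\mathrm{PG}(n,q)=\mathrm{AG}(n,q)\cup H_\infty$ ($H_\infty$ the hyperplane at infinity), it is an $(r,s)$-set (resp. $k$-general set) of $\mathrm{PG}(n,q)$. *)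

(* Defs.v *)
(* Projective geometry PG(n,q) over a finite field F with #|F| = q,
   modelled on the row space F^(n+1): a projective point is a 1-dimensional
   subspace, represented canonically by its genmx <<v>>%MS : 'M[F]_(n.+1);
   a projective subspace of dimension s is a linear subspace of rank s+1. *)
From HB Require Import structures.
From mathcomp Require Import all_boot all_order all_algebra all_fingroup.
Set Implicit Arguments. Unset Strict Implicit. Unset Printing Implicit Defensive.
Import GRing.Theory.
Local Open Scope ring_scope.

Section PG.
Variables (F : finFieldType) (n : nat).

Definition pts_in (X : {set 'M[F]_(n.+1)}) (U : 'M[F]_(n.+1)) : nat :=
  #|[set P in X | (P <= U)%MS]|.

Definition rs_set (r s : nat) (X : {set 'M[F]_(n.+1)}) : Prop :=
  [/\ (forall U : 'M[F]_(n.+1), \rank U = s.+1 -> (pts_in X U <= r)%N),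
      (forall U : 'M[F]_(n.+1), (forall P, P \in X -> (P <= U)%MS) -> \rank U = n.+1)
    & exists U : 'M[F]_(n.+1), \rank U = s.+2 /\ (r.+2 <= pts_in X U)%N].

Definition k_general (k : nat) (X : {set 'M[F]_(n.+1)}) : Prop :=
  rs_set k.-1 k.-2 X.

(* hyperplane at infinity H_inf : x_0 = 0 *)
Definition Hinf : 'M[F]_(n.+1) :=
  \matrix_(i < n.+1, j < n.+1) (((i == j) && (i != ord0))%:R).

Definition aff_pt (x : 'rV[F]_n) : 'M[F]_(n.+1) := <<row_mx (1 : 'rV[F]_1) x>>%MS.

Definition ag_to_pg (X : {set 'rV[F]_n}) : {set 'M[F]_(n.+1)} := [set aff_pt x | x in X].

Definition proj_act (M : 'M[F]_(n.+1)) (P : 'M[F]_(n.+1)) : 'M[F]_(n.+1) :=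
  <<P *m M>>%MS.

Definition stabilizes (M : 'M[F]_(n.+1)) (X : {set 'M[F]_(n.+1)}) : Prop :=
  [/\ M \in unitmx, [set proj_act M P | P in X] = X & (Hinf *m M == Hinf)%MS].

Definition transitive_set (X : {set 'M[F]_(n.+1)}) : Prop :=
  forall P Q, P \in X -> Q \in X ->
    exists M : 'M[F]_(n.+1), stabilizes M X /\ proj_act M P = Q.

End PG.

(* Main.v *)
(* Let L = GF(q^6), y = x^q, and let mu be the group of x in L with
   x^(q^2-q+1) = 1, so that the conjugates of x in mu are
   x, y, y/x, 1/x, 1/y, x/y; the set X is mu in the affine space L. An F-linear
   relation between points (1, x) of mu is then a relation for the L-span of
   1, x, y, y/x, 1/x, 1/y, x/y, i.e. for the hyperplane sections of a sextic del
   Pezzo surface.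
   - Five points are independent: the product of the determinants of
     (1, t, t^q) at u, v, x and at 1/u', 1/v', 1/x is such a section and meets mu
     in u, v, u', v' only.
   - Two independent hyperplanes meet mu in at most six points: times xy, their
     equations are quadratic in y, and the resultant is x times a polynomial of
     degree exactly 6 in x, whose leading coefficient is, up to sign, the product
     of two conjugates of the nonzero element a b^q - b a^q.
   - Six dependent points come from a pigeonhole argument on pairs {x, 1/x} if
     q > 4, and from a factor of the 13th cyclotomic polynomial if q = 4. Eight
     points in a hyperplane follow by counting in the pencil of hyperplanes
     through the 4-space spanned by six such points.
   Multiplication by mu gives transitivity. *)
Require Import Defs.
From HB Require Import structures.
From mathcomp Require Import all_boot all_order all_algebra all_fingroup.
From mathcomp Require Import cyclic falgebra fieldext separable galois finfield ring zify.
Set Implicit Arguments. Unset Strict Implicit. Unset Printing Implicit Defensive.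
Import GRing.Theory.
Local Open Scope ring_scope.

(** * Row relations and subspaces of prescribed rank *)

Section LinearAlgebra.
Variable F : fieldType.

Lemma rank_lt_relation m n (M : 'M[F]_(m, n)) :
  (\rank M < m)%N -> exists2 u : 'rV_m, u != 0 & u *m M = 0.
Proof.
move=> rM; have : kermx M != 0 by rewrite kermx_eq0 /row_free neq_ltn rM.
by case/rowV0Pn=> u /sub_kermxP uM u0; exists u.
Qed.

Lemma relation_rank_lt m n (M : 'M[F]_(m, n)) (u : 'rV_m) :
  u != 0 -> u *m M = 0 -> (\rank M < m)%N.
Proof.
move=> u0 uM; rewrite ltn_neqAle rank_leq_row andbT.
apply: contra u0 => fM; apply/eqP/(@row_free_inj _ _ _ _ M fM).
by rewrite uM mul0mx.
Qed.

Lemma submx_extend_rank m n (M : 'M[F]_(m, n)) r :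
  (\rank M <= r)%N -> (r <= n)%N ->
  exists2 U : 'M[F]_n, \rank U = r & (M <= U)%MS.
Proof.
move=> Mr rn; exists (pid_mx r *m row_ebase M).
  by rewrite mxrankMfree ?rank_pid_mx // row_free_unit row_ebase_unit.
rewrite -{1}(mulmx_ebase M).
have -> : pid_mx (\rank M) = (pid_mx (\rank M) : 'M_(m, n)) *m pid_mx r
    :> 'M[F]_(m, n).
  by rewrite mul_pid_mx; congr pid_mx; have := rank_leq_col M; lia.
by rewrite -!mulmxA mulmxA submxMl.
Qed.

(** The cokernel matrix of [U] has rank 2, so a base of its column space consists of two functionals
    that cut out [U]. *)
Lemma codim2_functionals n (U : 'M[F]_n.+2) : \rank U = n ->
  exists w1 w2 : 'cV[F]_n.+2,
    (forall v : 'rV_n.+2, (v <= U)%MS <-> v *m w1 = 0 /\ v *m w2 = 0) /\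
    (forall a b : F, a *: w1 + b *: w2 = 0 -> a = 0 /\ b = 0).
Proof.
move=> rU; have rC : \rank (cokermx U) = 2 by rewrite mxrank_coker rU; lia.
have Ufree := row_base_free (cokermx U); have Ufull := col_base_full (cokermx U).
have [W [WF WU]] : exists W : 'M[F]_(n.+2, 2), row_full W /\
    forall v : 'rV_n.+2, (v <= U)%MS = (v *m W == 0).
  have vU (v : 'rV_n.+2) : (v <= U)%MS = (v *m col_base (cokermx U) == 0).
    rewrite submxE -{1}(mulmx_base (cokermx U)) mulmxA.
    apply/eqP/eqP=> [v0|->]; last by rewrite mul0mx.
    by apply: (row_free_inj Ufree); rewrite v0 mul0mx.
  (* The rank occurs in the type of [col_base], which is therefore generalized before the rank is
     rewritten to 2. *)
  by move: (col_base _) Ufull vU; rewrite rC => W WF WU; exists W.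
have WE (v : 'rV_n.+2) j : (v *m col j W) 0 0 = (v *m W) 0 j.
  by rewrite !mxE; apply: eq_bigr => i _; rewrite mxE.
have M0 (A : 'M[F]_1) : A 0 0 = 0 -> A = 0.
  by move=> A0; apply/matrixP=> i j; rewrite !ord1 A0 mxE.
exists (col 0 W), (col 1 W); split=> [v | a b ab0].
  rewrite WU; split=> [/eqP v0 | [v0 v1]].
    by split; apply: M0; rewrite WE v0 mxE.
  apply/eqP/matrixP=> i j; rewrite ord1 [RHS]mxE -WE.
  by case: j => [[|[|]]] //= ij;
    [move: v0 | move: v1] => /matrixP/(_ 0 0); rewrite [in RHS]mxE => <-;
    congr ((_ *m col _ W) _ _); apply: val_inj.
pose c : 'cV[F]_2 := \col_j if j == 0 then a else b.
have c0 : c = 0.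
  apply: (row_full_inj WF); rewrite mulmx0 -ab0; apply/matrixP=> i j.
  by rewrite !mxE !big_ord_recl big_ord0 !mxE /= addr0 mulrC
    [X in _ + X]mulrC; congr (_ * W _ _ + _ * W _ _); apply: val_inj.
by split; [move/matrixP/(_ 0 0): c0 | move/matrixP/(_ 1 0): c0]; rewrite !mxE.
Qed.

End LinearAlgebra.

(** * Extensions of a finite field of prescribed degree *)

Section FiniteFieldExtension.
Variable F : finFieldType.

(* The splitting field of ['X^(q^k) - 'X] consists of the roots of that
   polynomial, since these are fixed by the [k]-th power of the Frobenius. *)
Lemma finField_extension_exists k : (0 < k)%N ->
  exists L : fieldExtType F, \dim {:L} = k.
Proof.
move=> k0; set Q := (#|F| ^ k)%N.
have F1 : (1 < #|F|)%N := finNzRing_gt1 F.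
have Q1 : (1 < Q)%N by rewrite -(expn0 #|F|) ltn_exp2l.
have sizeP (R : nzRingType) : size ('X^Q - 'X : {poly R}) = Q.+1.
  by rewrite size_polyDl size_polyXn // size_polyN size_polyX.
have p0 : 'X^Q - 'X != 0 :> {poly F} by rewrite -size_poly_eq0 sizeP.
have [L [rs Drs defL]] := FinSplittingFieldFor p0; exists L; move: Drs defL.
rewrite rmorphB /= map_polyXn map_polyX => Drs defL.
have [p p_pr charFp] := finPcharP F.
have QL : Q%:R = 0 :> L.
  rewrite -(rmorph_nat (GRing.in_alg L)); apply/eqP; rewrite fmorph_eq0.
  rewrite -(dvdn_pcharf charFp) dvdn_exp //.
  move: F1; rewrite (card_pprimeChar charFp); case: (logn _ _) => // n _.
  exact: dvdn_exp.
(* The derivative of ['X^Q - 'X] is [-1], because [Q] vanishes in [L]; so all roots are simple. *)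
have Urs : uniq rs.
  rewrite -separable_prod_XsubC -(eqp_separable Drs) separable_poly.unlock.
  by rewrite derivB derivXn derivX -mulr_natr -polyC_natr QL mulr0 sub0r
    -(scaleN1r 1) coprimepZr ?oppr_eq0 ?oner_eq0 ?coprimep1.
have srs : size rs = Q.
  by apply: succn_inj; rewrite -(size_prod_XsubC rs id) -(eqp_size Drs) sizeP.
have [al _ alE] := finField_galois_generator (sub1v {:L}%AS).
have alk j x : (al ^+ j)%g x = x ^+ (#|F| ^ j).
  elim: j => [|j IHj]; first by rewrite expg0 gal_id.
  by rewrite expgSr galM ?memvf // alE ?memvf // IHj -exprM dimv1 expn1 expnSr.
have in_rs x : (x \in rs) = (x ^+ Q == x).
  by rewrite -root_prod_XsubC -(eqp_root Drs) rootE !hornerE subr_eq0.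
have all_rs x : x \in rs.
  have : ({:L} <= fixedField [set (al ^+ k)%g])%VS.
    rewrite -defL; apply/Fadjoin_seqP; split=> [|y]; first exact: sub1v.
    rewrite in_rs => /eqP yQ; apply/fixedFieldP; first exact: memvf.
    by move=> _ /set1P->; rewrite alk.
  move/subvP/(_ x (memvf x))/mem_fixedFieldP=> [_ /(_ _ (set11 _))].
  by rewrite alk in_rs => /eqP.
have cL : #|finvect_type L| = Q.
  pose rs' : seq (finvect_type L) := rs; have Urs' : uniq rs' := Urs.
  transitivity #|rs'|; last by rewrite (card_uniqP Urs').
  by apply: eq_card => x; rewrite [RHS]all_rs.
apply: (@expnI #|F|) => //.
by rewrite -[RHS]cL -(card_vspacef (Vector.class (finvect_type L))) card_vspace.
Qed.

(** Stated with [in_alg] and plain functions, so that what follows can work with an embedding of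
    finite fields. *)
Lemma fieldExt_coordinates (L : fieldExtType F) n : \dim {:L} = n ->
  exists (e : 'I_n -> L) (co : L -> 'I_n -> F),
    (forall z, z = \sum_i GRing.in_alg L (co z i) * e i) /\
    (forall c : 'I_n -> F,
       \sum_i GRing.in_alg L (c i) * e i = 0 -> forall i, c i = 0).
Proof.
move=> <-; pose b := vbasis {:L}.
have sumE (c : 'I_(\dim {:L}) -> F) :
    \sum_i GRing.in_alg L (c i) * b`_i = \sum_i c i *: b`_i.
  by apply: eq_bigr => i _; rewrite /= mulr_algl.
exists (fun i => b`_i), (fun z i => coord b i z); split=> [z|c].
  by rewrite sumE -coord_vbasis ?memvf.
by rewrite sumE; apply/freeP/basis_free/vbasisP.
Qed.

End FiniteFieldExtension.

(** * The Frobenius map of [L] over [F] as a ring morphism *)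

Definition frob (F L : finFieldType) (iota : {rmorphism F -> L}) (x : L) : L :=
  x ^+ #|F|.

Section FrobeniusMorphism.
Variables (F L : finFieldType) (iota : {rmorphism F -> L}).

(** The embedding [iota] forces [L] to have the characteristic of [F], and [#|F|] is a power of
    it. *)
Lemma frob_is_zmod_morphism : zmod_morphism (frob iota).
Proof.
have [p p_pr charFp] := finPcharP F.
have charLp : p \in [pchar L] by rewrite (fmorph_pchar iota).
have pF : [pchar L].-nat #|F|.
  rewrite (eq_pnat _ (pcharf_eq charLp)).
  by rewrite (card_pprimeChar charFp) pnatX pnat_id.
move=> x y; apply: (addIr (frob iota y)).
by rewrite /frob subrK -exprDn_pchar // subrK.
Qed.

Lemma frob_is_monoid_morphism : monoid_morphism (frob iota).
Proof. by split=> [|x y]; rewrite /frob ?expr1n ?exprMn. Qed.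

HB.instance Definition _ :=
  GRing.isZmodMorphism.Build L L (frob iota) frob_is_zmod_morphism.
HB.instance Definition _ :=
  GRing.isMonoidMorphism.Build L L (frob iota) frob_is_monoid_morphism.

End FrobeniusMorphism.

(** * The group [mu] in the field of order [q^6] *)

Section NormOneGroup.
Variables (F L : finFieldType) (iota : {rmorphism F -> L}).
Local Notation q := #|F|.
Local Notation fr := (frob iota).
Hypothesis cardL : #|L| = (q ^ 6)%N.

Lemma frob_iota c : fr (iota c) = iota c.
Proof. by rewrite /frob -rmorphXn /= expf_card. Qed.

(** Over [F] the polynomial ['X^q - 'X] is the product of all ['X - c], so its roots in [L] come
    from [F]. *)
Lemma frob_fixedP (z : L) : fr z = z -> exists c, z = iota c.
Proof.
move=> zq; have := congr1 (fun p => (map_poly iota p).[z]) (finField_genPoly F).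
rewrite rmorphB /= map_polyXn map_polyX !hornerE [_ ^+ _]zq subrr => /esym/eqP.
rewrite rmorph_prod horner_prod => /prodf_eq0[c _].
rewrite rmorphB /= map_polyX map_polyC !hornerE subr_eq0 => /eqP->.
by exists c.
Qed.

Lemma frob_iter k (x : L) : iter k fr x = x ^+ (q ^ k).
Proof. by elim: k => [|k IHk] //=; rewrite IHk /frob -exprM expnSr. Qed.

Lemma frob6 (x : L) : fr (fr (fr (fr (fr (fr x))))) = x.
Proof. by rewrite -[LHS]/(iter 6 fr x) frob_iter -cardL expf_card. Qed.

Definition muN := (q ^ 2 - q + 1)%N.
Definition mu : {set L} := [set x | x ^+ muN == 1].

Lemma q_gt1 : (1 < q)%N. Proof. exact: finNzRing_gt1. Qed.

Lemma muP x : reflect (x ^+ muN = 1) (x \in mu).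
Proof. by rewrite inE; apply: eqP. Qed.

Lemma mu1 : 1 \in mu. Proof. by rewrite inE expr1n. Qed.

Lemma muM x y : x \in mu -> y \in mu -> x * y \in mu.
Proof. by move=> /muP xm /muP ym; apply/muP; rewrite exprMn xm ym mulr1. Qed.

Lemma muV x : x \in mu -> x^-1 \in mu.
Proof. by move=> /muP xm; apply/muP; rewrite exprVn xm invr1. Qed.

Lemma mu_neq0 x : x \in mu -> x != 0.
Proof.
move=> /muP xm; apply/eqP=> x0; move/eqP: xm.
by rewrite x0 /muN addn1 expr0n /= eq_sym oner_eq0.
Qed.

(** Since [q^2 + 1 = q + muN], the power [x^(q^2 + 1)] equals [x^q]. Hence all conjugates of [x] are
    monomials in [x] and [x^q]. *)
Lemma frob2_mu x : x \in mu -> fr (fr x) = fr x / x.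
Proof.
move=> xm; have x0 := mu_neq0 xm; apply: (mulIf x0); rewrite divfK //.
move/muP: xm => xm; rewrite /frob -exprM -exprSr -[RHS]mulr1 -xm -exprD.
by congr (_ ^+ _); rewrite /muN; have := q_gt1; nia.
Qed.

Lemma frob3_mu x : x \in mu -> fr (fr (fr x)) = x^-1.
Proof.
move=> xm; have x0 := mu_neq0 xm; rewrite (frob2_mu xm) fmorph_div /= (frob2_mu xm).
have : fr x != 0 by rewrite fmorph_eq0.
by move: (fr x) => y y0; field; rewrite x0 y0.
Qed.

Lemma mu_frob_id x : x \in mu -> fr x = x -> x = 1.
Proof.
move=> xm xq; have := frob2_mu xm; rewrite !xq divff // mu_neq0 //.
Qed.

Lemma mu_prim_root : exists h : L, muN.-primitive_root h.
Proof.
have dvN : (muN %| #|L|.-1)%N.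
  (* The factorization is [q^6 - 1 = (q^3 - 1) (q + 1) (q^2 - q + 1)]. *)
  apply/dvdnP; exists ((q ^ 3 - 1) * (q + 1))%N; rewrite cardL /muN.
  by have := q_gt1; move: q => k k1; apply: succn_inj; rewrite prednK ?expn_gt0; nia.
have L0 : (0 < #|L|.-1)%N by rewrite ltn_predRL finNzRing_gt1.
have /hasP[z _ prz] : has (#|L|.-1).-primitive_root (enum [set~ (0 : L)]).
  apply: has_prim_root => //; rewrite ?enum_uniq -?cardE ?cardsC1 //.
  apply/allP=> x; rewrite mem_enum !inE => x0; rewrite unity_rootE.
  apply/eqP/(mulfI x0); rewrite mulr1 -exprS prednK ?expf_card //.
  exact: ltnW (finNzRing_gt1 L).
by exists (z ^+ (#|L|.-1 %/ muN)); apply: dvdn_prim_root.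
Qed.

Lemma card_mu : #|mu| = muN.
Proof.
have [h prh] := mu_prim_root.
have -> : mu = [set h ^+ (i : nat) | i : 'I_muN].
  apply/setP=> x; apply/muP/imsetP=> [xm|[i _ ->]]; last first.
    by rewrite exprAC (prim_expr_order prh) expr1n.
  by have [i ->] := prim_rootP prh xm; exists i.
rewrite card_imset ?card_ord // => i j /eqP.
by rewrite (eq_prim_root_expr prh) !modn_small // => /eqP/val_inj.
Qed.

(** * The trace onto [F], and determinants of triples in [mu] *)

Definition tr (z : L) : L :=
  z + fr z + fr (fr z) + fr (fr (fr z)) + fr (fr (fr (fr z)))
    + fr (fr (fr (fr (fr z)))).

Lemma frob_tr z : fr (tr z) = tr z.
Proof. by rewrite /tr !rmorphD /= frob6; ring. Qed.

Lemma frob4_mu x : x \in mu -> fr (fr (fr (fr x))) = (fr x)^-1.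
Proof. by move=> xm; rewrite (frob3_mu xm) fmorphV. Qed.

Lemma frob5_mu x : x \in mu -> fr (fr (fr (fr (fr x)))) = x / fr x.
Proof.
by move=> xm; rewrite (frob4_mu xm) fmorphV /= (frob2_mu xm) invf_div.
Qed.

Lemma tr_mu a x : x \in mu -> let y := fr x in
  tr (a * x) = a * x + fr a * y + fr (fr a) * (y / x) + fr (fr (fr a)) * x^-1
    + fr (fr (fr (fr a))) * y^-1 + fr (fr (fr (fr (fr a)))) * (x / y).
Proof.
move=> xm /=; rewrite /tr !rmorphM /=.
by rewrite (frob5_mu xm) (frob4_mu xm) (frob3_mu xm) (frob2_mu xm).
Qed.

(** As a polynomial the trace has degree [q^5], too small for [q^6] roots. *)
Lemma tr_neq0 : ~ (forall w : L, tr w = 0).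
Proof.
move=> tr0; pose P : {poly L} := \sum_(k < 6) 'X^(q ^ k).
have sP : size P = (q ^ 5).+1.
  rewrite /P big_ord_recr /= addrC size_polyDl size_polyXn // ltnS.
  apply: (leq_trans (size_sum _ _ _)); apply/bigmax_leqP=> i _.
  by rewrite size_polyXn ltn_exp2l ?q_gt1.
have P0 : P != 0 by rewrite -size_poly_eq0 sP.
have rP : all (root P) (enum L).
  apply/allP=> w _; rewrite rootE -(tr0 w) /P horner_sum !big_ord_recl big_ord0.
  by rewrite !hornerXn -!frob_iter /tr /= addr0 !addrA.
have := max_poly_roots P0 rP (enum_uniq _).
by rewrite -cardE cardL sP ltnS leq_exp2l ?q_gt1.
Qed.

Lemma tr_nondegenerate z : (forall w, tr (w * z) = 0) -> z = 0.
Proof.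
move=> tr0; apply/eqP/negPn/negP => z0; apply: tr_neq0 => w.
by rewrite -(divfK z0 w).
Qed.

(* [det3 u v w] is the determinant of the rows [(1, t, t^q)], [t = u, v, w]. *)
Definition det3 (u v w : L) : L := (v - u) * fr (w - u) - fr (v - u) * (w - u).

(** If the determinant vanishes, [t = (w - u) / (v - u)] is fixed by Frobenius. The cube of
    Frobenius inverts [mu], so the reciprocals of the three points satisfy the same relation with
    the same [t]; together the two relations make two of the points coincide. *)
Lemma det3_neq0 u v w : u \in mu -> v \in mu -> w \in mu ->
  u != v -> u != w -> v != w -> det3 u v w != 0.
Proof.
move=> um vm wm uv uw vw; apply: contra uw; rewrite subr_eq0 => /eqP D0.
have vu : v - u != 0 by rewrite subr_eq0 eq_sym.
have fvu : fr (v - u) != 0 by rewrite fmorph_eq0.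
pose t := (w - u) / (v - u).
have tE : w - u = t * (v - u) by rewrite divfK.
have tq : fr t = t.
  rewrite /t fmorph_div /=; apply: (mulIf fvu); rewrite divfK //.
  by apply: (mulfI vu); rewrite D0; field.
have := congr1 (fun z => fr (fr (fr z))) tE.
do 3! rewrite rmorphM /= tq; rewrite !rmorphB /=.
rewrite !frob3_mu // => tE'.
have [u0 v0 w0] := And3 (mu_neq0 um) (mu_neq0 vm) (mu_neq0 wm).
have : v * (u - w) = w * (u - w).
  have -> : v * (u - w) = u * v * w * (w^-1 - u^-1) by field; rewrite u0 w0.
  rewrite tE'; have -> : u * v * w * (t * (v^-1 - u^-1)) = - (w * (t * (v - u))).
    by field; rewrite u0 v0.
  by rewrite -tE; ring.
move/eqP; rewrite -subr_eq0 -mulrBl mulf_eq0 !subr_eq0.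
by rewrite (negPf vw).
Qed.

(** * Relations over [F] between points of [mu] *)

Lemma frob_relation n (c : 'I_n -> F) (g : 'I_n -> L) :
  \sum_i iota (c i) * g i = 0 -> \sum_i iota (c i) * fr (g i) = 0.
Proof.
move=> /(congr1 fr); rewrite rmorph0 rmorph_sum => {2}<-.
by apply: eq_bigr => i _; rewrite rmorphM /= frob_iota.
Qed.

(** Iterated Frobenius carries the given relation to each of the six conjugates. The exponents of
    the six monomials in [t] and [fr t] are the vertices of a hexagon with the constant term at its
    centre. *)
Lemma hexagon_relation n (c : 'I_n -> F) (x : 'I_n -> L) (g : L -> L)
    k0 k1 k2 k3 k4 k5 k6 :
  (forall i, x i \in mu) ->
  (forall t, t \in mu -> g t = k0 + k1 * t + k2 * fr t + k3 * (fr t / t)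
      + k4 * t^-1 + k5 * (fr t)^-1 + k6 * (t / fr t)) ->
  \sum_i c i = 0 -> \sum_i iota (c i) * x i = 0 ->
  \sum_i iota (c i) * g (x i) = 0.
Proof.
move=> xm gE c0 r0; have r1 := frob_relation r0; have r2 := frob_relation r1.
have r3 := frob_relation r2; have r4 := frob_relation r3.
have r5 := frob_relation r4.
transitivity (k0 * iota (\sum_i c i) + k1 * (\sum_i iota (c i) * x i)
  + k2 * (\sum_i iota (c i) * fr (x i))
  + k3 * (\sum_i iota (c i) * fr (fr (x i)))
  + k4 * (\sum_i iota (c i) * fr (fr (fr (x i))))
  + k5 * (\sum_i iota (c i) * fr (fr (fr (fr (x i)))))
  + k6 * (\sum_i iota (c i) * fr (fr (fr (fr (fr (x i)))))));
  last by rewrite c0 r0 r1 r2 r3 r4 r5 rmorph0; ring.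
rewrite rmorph_sum !mulr_sumr -!big_split /=; apply: eq_bigr => i _.
rewrite (gE _ (xm i)) frob5_mu // frob4_mu // frob3_mu // frob2_mu //.
ring.
Qed.

(* The product of two determinants lies in the span of the seven functions of
   [hexagon_relation]; it vanishes at [u], [v], [u'], [v'] and nowhere else on
   [mu]. *)
Lemma det3_relation n (c : 'I_n -> F) (x : 'I_n -> L) u v u' v' :
  (forall i, x i \in mu) ->
  \sum_i c i = 0 -> \sum_i iota (c i) * x i = 0 ->
  \sum_i iota (c i) * (det3 u v (x i) * det3 u'^-1 v'^-1 (x i)^-1) = 0.
Proof.
move=> xm c0 r0.
pose a := fr (v - u) * u - (v - u) * fr u.
pose b := - fr (v - u).
pose d := v - u.
pose a' := fr (v'^-1 - u'^-1) * u'^-1 - (v'^-1 - u'^-1) * fr u'^-1.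
pose b' := - fr (v'^-1 - u'^-1).
pose d' := v'^-1 - u'^-1.
(* With [y = fr t], these are the coefficients of [(a + b t + d y) (a' + b'/t + d'/y)]. *)
apply: (@hexagon_relation _ _ _ (fun t => det3 u v t * det3 u'^-1 v'^-1 t^-1)
  (a * a' + b * b' + d * d') (a' * b) (a' * d) (d * b') (a * b') (a * d')
  (b * d')) => // t tm.
have -> : det3 u v t = a + b * t + d * fr t.
  by rewrite /det3 /a /b /d (rmorphB (fr) t); ring.
have -> : det3 u'^-1 v'^-1 t^-1 = a' + b' * t^-1 + d' * (fr t)^-1.
  by rewrite /det3 /a' /b' /d' (rmorphB (fr) t^-1) (fmorphV (fr) t) /=; ring.
have t0 := mu_neq0 tm; have y0 : fr t != 0 by rewrite fmorph_eq0.
by move: (fr t) y0 => y y0; field; rewrite t0 y0.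
Qed.

(** With the other four points as [u], [v], [u'], [v'], only the term of [x k] survives in
    [det3_relation]. *)
Lemma mu_independent5 (x : 'I_5 -> L) (c : 'I_5 -> F) :
  injective x -> (forall i, x i \in mu) ->
  \sum_i c i = 0 -> \sum_i iota (c i) * x i = 0 -> forall k, c k = 0.
Proof.
move=> x_inj xm c0 r0 k.
pose z (j : 'I_4) := x (lift k j).
have z_inj i j : i != j -> z i != z j.
  by move=> ij; rewrite (inj_eq x_inj) (inj_eq lift_inj).
have zk j : z j != x k by rewrite (inj_eq x_inj) eq_sym neq_lift.
pose j0 : 'I_4 := inord 0; pose j1 : 'I_4 := inord 1.
pose j2 : 'I_4 := inord 2; pose j3 : 'I_4 := inord 3.
have dj : (j0 != j1) && (j2 != j3) by rewrite -!val_eqE /= !inordK.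
have [d01 d23] := andP dj.
have := det3_relation (z j0) (z j1) (z j2) (z j3) xm c0 r0.
rewrite (bigD1 k) //= big1 ?addr0 => [|i ik].
  move/eqP; rewrite mulf_eq0 fmorph_eq0 => /orP[/eqP // | /idPn[]].
  rewrite mulf_neq0 // det3_neq0 ?muV ?(inj_eq invr_inj) //; try exact: xm.
  - exact: z_inj.
  - exact: z_inj.
have [j ij|ik'] := unliftP k i; last by rewrite ik' eqxx in ik.
suff -> : det3 (z j0) (z j1) (x i) * det3 (z j2)^-1 (z j3)^-1 (x i)^-1 = 0.
  by rewrite mulr0.
have -> : x i = z j by rewrite ij.
have det3ll u v : det3 u v u = 0 by rewrite /det3 subrr rmorph0; ring.
have det3lr u v : det3 u v v = 0 by rewrite /det3; ring.
have : [|| j == j0, j == j1, j == j2 | j == j3].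
  by rewrite -!val_eqE /= !inordK //; case: j {ij} => [[|[|[|[]]]]].
by case/or4P=> /eqP->; rewrite ?det3ll ?det3lr ?(mul0r, mulr0).
Qed.

(** * Common zeros on [mu] of two hyperplane equations *)

Lemma mu_pencil_bound (al be : F) (a b : L) :
  a * fr b - b * fr a != 0 ->
  (#|[set x in mu | (iota al + tr (a * x) == 0)%R
       && (iota be + tr (b * x) == 0)%R]| <= 6)%N.
Proof.
move=> w0.
set a1 := fr a in w0; set a2 := fr a1; set a3 := fr a2; set a4 := fr a3.
set a5 := fr a4; set b1 := fr b in w0; set b2 := fr b1; set b3 := fr b2.
set b4 := fr b3; set b5 := fr b4.
have w5 : a * b5 - b * a5 != 0.
  (* Frobenius maps this element to the negative of the one in [w0]. *)
  rewrite -(fmorph_eq0 fr) rmorphB !rmorphM /= /a5 /b5 !frob6.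
  by rewrite -/a1 -/b1 -oppr_eq0; move: w0; congr (_ != _); ring.
set A := iota al; set B := iota be.
(* These are [U], [V], [W] below, the 2 by 2 minors of the coefficients of the two quadratics in
   [y]. [P2] and [P3] have degree 3 and [P1] at most 2, so [x U^2 - V W] has degree 6. *)
pose P1 : {poly L} := Poly [:: a2 * b4 - b2 * a4;
  a1 * b4 + a2 * b5 - b1 * a4 - b2 * a5; a1 * b5 - b1 * a5].
pose P2 : {poly L} := Poly [:: a2 * b3 - b2 * a3;
  a1 * b3 + a2 * B - b1 * a3 - b2 * A; a1 * B + a2 * b - b1 * A - b2 * a;
  a1 * b - b1 * a].
pose P3 : {poly L} := Poly [:: a3 * b4 - b3 * a4;
  A * b4 + a3 * b5 - B * a4 - b3 * a5; a * b4 + A * b5 - b * a4 - B * a5;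
  a * b5 - b * a5].
have s2 : size P2 = 4.
  rewrite /P2 (@PolyK _ 0) //= -oppr_eq0; move: w0; congr (_ != _); ring.
have s3 : size P3 = 4 by rewrite /P3 (@PolyK _ 0).
have P20 : P2 != 0 by rewrite -size_poly_eq0 s2.
have P30 : P3 != 0 by rewrite -size_poly_eq0 s3.
have sP : size ('X * P1 ^+ 2 - P2 * P3) = 7.
  have s23 : size (P2 * P3) = 7 by rewrite size_mul // s2 s3.
  rewrite addrC size_polyDl size_polyN s23 //.
  apply: leq_trans (size_mul_leq _ _) _; rewrite size_polyX.
  have := size_exp_leq P1 2; have : (size P1 <= 3)%N by apply: size_Poly.
  lia.
have P0 : 'X * P1 ^+ 2 - P2 * P3 != 0 by rewrite -size_poly_eq0 sP.
set S := [set x in _ | _].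
have rS : all (root ('X * P1 ^+ 2 - P2 * P3)) (enum S).
  apply/allP=> x; rewrite mem_enum => /setIdP[xm].
  rewrite !tr_mu //= => /andP[/eqP fx /eqP gx].
  rewrite rootE !hornerE /=.
  have x0 := mu_neq0 xm; have : fr x != 0 by rewrite fmorph_eq0.
  rewrite -!/a1 -!/a2 -!/a3 -!/a4 -!/a5 -!/b1 -!/b2 -!/b3 -!/b4 -!/b5 in fx gx.
  move: (fr x) fx gx => y fx gx y0.
  pose f2 := a1 * x + a2; pose f1 := a * x ^+ 2 + A * x + a3.
  pose f0 := a5 * x + a4.
  pose g2 := b1 * x + b2; pose g1 := b * x ^+ 2 + B * x + b3.
  pose g0 := b5 * x + b4.
  have fE : f2 * y ^+ 2 + f1 * y + x * f0 = 0.
    rewrite -[RHS](mulr0 (x * y)) -fx /f2 /f1 /f0 /A; field.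
    by rewrite x0 y0.
  have gE : g2 * y ^+ 2 + g1 * y + x * g0 = 0.
    rewrite -[RHS](mulr0 (x * y)) -gx /g2 /g1 /g0 /B; field.
    by rewrite x0 y0.
  pose U := f2 * g0 - g2 * f0; pose V := f2 * g1 - g2 * f1.
  pose W := f1 * g0 - g1 * f0.
  have VU : V * y + x * U = 0.
    transitivity (f2 * (g2 * y ^+ 2 + g1 * y + x * g0)
                - g2 * (f2 * y ^+ 2 + f1 * y + x * f0)).
      by rewrite /U /V; ring.
    by rewrite fE gE; ring.
  have UW : U * y + W = 0.
    apply: (mulfI y0); transitivity (g0 * (f2 * y ^+ 2 + f1 * y + x * f0)
      - f0 * (g2 * y ^+ 2 + g1 * y + x * g0)); first by rewrite /U /W; ring.
    by rewrite fE gE; ring.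
  apply/eqP; transitivity (x * U ^+ 2 - V * W).
    by rewrite /U /V /W /f2 /f1 /f0 /g2 /g1 /g0; ring.
  have -> : x * U ^+ 2 - V * W = U * (V * y + x * U) - V * (U * y + W) by ring.
  by rewrite VU UW; ring.
have := max_poly_roots P0 rS (enum_uniq _).
by rewrite sP -cardE.
Qed.

(** * Six dependent points of [mu] *)

(** The relation is nontrivial through its first coefficient, which is 1 in both constructions. *)
Definition dependent6 := exists (s : seq L) (c : seq F),
  [/\ size s = 6, uniq s, {subset s <= mu} & [/\ c`_0 != 0,
    \sum_(i < 6) c`_i = 0 & \sum_(i < 6) iota c`_i * s`_i = 0]].

(** The order [q (q - 1) + 1] of [mu] is odd, so there is no involution. *)
Lemma mu_inv_id x : x \in mu -> x = x^-1 -> x = 1.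
Proof.
move=> xm xV; have x0 := mu_neq0 xm.
have x2 : x ^+ 2 = 1 by rewrite expr2 {2}xV divff.
move/muP: xm; have -> : muN = (2 * (q * (q - 1))./2).+1.
  have qE : odd (q * (q - 1)) = false.
    by rewrite oddM oddB ?(ltnW q_gt1) //= addbT andbN.
  have := odd_double_half (q * (q - 1)); rewrite qE add0n mul2n => ->.
  by rewrite /muN -mulnn mulnBr muln1 addn1.
by rewrite exprS exprM x2 expr1n mulr1.
Qed.

Lemma exists_mu_neq1 : exists2 x : L, x \in mu & x != 1.
Proof.
have : (1 < #|mu|)%N by rewrite card_mu /muN; have := q_gt1; nia.
case/card_gt1P=> x [y [xm ym xy]]; have [x1|x1] := eqVneq x 1; last by exists x.
by exists y => //; rewrite -x1 eq_sym.
Qed.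

(* Writing [d x = x - x^-1], all quotients [e x = d x / d x1] lie in the cubic
   subfield, so [s = e^q - e] has trace zero there and [s^(q-1)] is a root of
   ['X^(q+1) + 'X + 1]. By pigeonhole two classes [{x, x^-1}] give the same
   root, which makes [d x1], [d x2], [d x3] linearly dependent over [F]. *)
Lemma mu_dependent6_large : (4 < q)%N -> dependent6.
Proof.
move=> q5.
have [x1 x1m x11] := exists_mu_neq1.
pose d (x : L) := x - x^-1.
have dneq0 x : x \in mu -> x != 1 -> d x != 0.
  by move=> xm; apply: contra; rewrite subr_eq0 => /eqP /(mu_inv_id xm) ->.
have d3 x : x \in mu -> fr (fr (fr (d x))) = - d x.
  by move=> xm; rewrite /d !rmorphB !fmorphV /= frob3_mu // invrK; ring.
have d10 := dneq0 _ x1m x11.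
pose e x := d x / d x1.
have e3 x : x \in mu -> fr (fr (fr (e x))) = e x.
  by move=> xm; rewrite /e !fmorph_div /= !d3 // invrN mulrNN.
pose s x := fr (e x) - e x.
have x1V : x1 != x1^-1.
  by apply: contra x11 => /eqP xV; apply/eqP; apply: mu_inv_id.
pose D := mu :\: [set 1; x1; x1^-1].
have inD x : x \in D -> [/\ x \in mu, x != 1, x != x1 & x != x1^-1].
  by rewrite in_setD !in_setU !in_set1 !negb_or -!andbA => /and4P[].
have xVneq x : x \in mu -> x != 1 -> x != x^-1.
  by move=> xm; apply: contra => /eqP xV; apply/eqP; apply: mu_inv_id.
have VV (u v : L) : (u^-1 == v) = (u == v^-1).
  by rewrite -(inj_eq invr_inj) invrK.
have sneq0 x : x \in D -> s x != 0.
  case/inD=> xm x_1 xx1 xx1V; rewrite subr_eq0; apply/eqP=> /frob_fixedP[k ek].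
  have dk : d x = iota k * d x1 by rewrite -ek /e divfK.
  (* The relation concerns four points; 1 joins them with coefficient 0, to apply
     [mu_independent5]. *)
  pose t := [:: x; x^-1; x1; x1^-1; 1].
  have ut : uniq t.
    rewrite /= !inE !negb_or !(inj_eq invr_inj) !VV invr1.
    by rewrite (xVneq x) //= xx1 xx1V x_1 x1V x11.
  have t_inj : injective (fun i : 'I_5 => t`_i).
    by move=> i j /eqP; rewrite nth_uniq // => /eqP/val_inj.
  have tm (i : 'I_5) : t`_i \in mu.
    by case: i => [[|[|[|[|[|]]]]]] //= _; rewrite ?muV // mu1.
  pose c := [:: 1; -1; -k; k; 0].
  have c0 : \sum_(i < 5) c`_i = 0 by rewrite !big_ord_recl big_ord0 /=; ring.
  have ct : \sum_(i < 5) iota c`_i * t`_i = 0.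
    rewrite !big_ord_recl big_ord0 /= rmorph1 rmorph0 !rmorphN rmorph1.
    have dk0 : d x - iota k * d x1 = 0 by rewrite dk subrr.
    by rewrite -[RHS]dk0 /d; ring.
  by have /eqP := mu_independent5 t_inj tm c0 ct ord0; rewrite oner_eq0.
pose r x := fr (s x) / s x.
pose T : {poly L} := 'X^(q.+1) + ('X + 1).
have sT : size T = q.+2.
  by rewrite /T size_polyDl size_polyXn // size_XaddC; lia.
have T0 : T != 0 by rewrite -size_poly_eq0 sT.
pose Z := [set z : L | root T z].
have cZ : (#|Z| <= q.+1)%N.
  rewrite cardE -ltnS -sT; apply: max_poly_roots; rewrite ?enum_uniq //.
  by apply/allP=> z; rewrite mem_enum inE.
have rZ x : x \in D -> r x \in Z.
  move=> xD; have s0 := sneq0 x xD; have [xm _ _ _] := inD _ xD.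
  rewrite inE rootE !hornerE exprSr -[_ ^+ q]/(fr (r x)) /r fmorph_div /=.
  have fs0 : fr (s x) != 0 by rewrite fmorph_eq0.
  have s3 : fr (fr (s x)) = - s x - fr (s x).
    by rewrite /s !rmorphB /= e3 //; ring.
  rewrite s3; apply/eqP; move: (fr (s x)) fs0 => v v0; field.
  by rewrite s0 v0.
have cD : #|D| = (muN - 3)%N.
  rewrite cardsD card_mu; congr (_ - _)%N.
  rewrite (setIidPr _); last first.
    by apply/subsetP=> x; rewrite !in_setU !in_set1 -orbA
      => /or3P[] /eqP->; rewrite ?muV ?mu1.
  by rewrite -setUA cardsU1 cards2 !inE x1V !(eq_sym 1) invr_eq1 (negPf x11).
have [t tZ ct] : exists2 t, t \in Z & (2 < #|[set x in D | r x == t]|)%N.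
  apply/exists_inP; apply: contraT; rewrite negb_exists_in => /forall_inP H.
  (* Here [q > 4] enters: [q^2 - q - 2 > 2 (q + 1)] amounts to [(q - 4) (q + 1) > 0]. *)
  suff : (#|D| <= 2 * q.+1)%N by rewrite cD /muN; nia.
  rewrite -sum1_card (partition_big r (mem Z)) //=.
  apply: (@leq_trans (\sum_(t in Z) 2)%N); last by rewrite sum_nat_const mulnC leq_mul2l cZ.
  by apply: leq_sum => t /H; rewrite -leqNgt; apply: leq_trans; rewrite sum1dep_card.
have [x2 [x3 [x2D x3D r23 x23 x23V]]] : exists x2 x3,
    [/\ x2 \in D, x3 \in D, r x2 = r x3, x2 != x3 & x3 != x2^-1].
  case/card_gt2P: ct => x [y [z [[]]]].
  move=> /setIdP[xD /eqP rx] /setIdP[yD /eqP ry] /setIdP[zD /eqP rz] [xy yz zx].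
  (* If [y] is the inverse of [x], then [z] is not. *)
  have [yx|yx] := eqVneq y x^-1; last by exists x, y; rewrite rx ry.
  by exists x, z; rewrite rx rz -yx; split=> //; rewrite eq_sym.
have [x2m x2_1 x2_x1 x2_x1V] := inD _ x2D.
have [x3m x3_1 x3_x1 x3_x1V] := inD _ x3D.
have s20 := sneq0 _ x2D; have s30 := sneq0 _ x3D.
have [l lE] : exists l, s x2 / s x3 = iota l.
  apply: frob_fixedP; rewrite fmorph_div /=.
  have f30 : fr (s x3) != 0 by rewrite fmorph_eq0.
  move: r23; rewrite /r => /(congr1 ( *%R (s x2))); rewrite mulrC divfK // => ->.
  by field; rewrite f30 s30.
have s2E : s x2 = iota l * s x3 by rewrite -lE divfK.
(* Frobenius minus the identity maps this combination to [s x2 - iota l * s x3 = 0]. *)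
have [k kE] : exists k, e x2 - iota l * e x3 = iota k.
  apply: frob_fixedP; rewrite rmorphB (rmorphM fr (iota l)) /= frob_iota.
  have -> : fr (e x2) = s x2 + e x2 by rewrite subrK.
  have -> : fr (e x3) = s x3 + e x3 by rewrite subrK.
  by rewrite s2E; ring.
have dE : d x2 - iota l * d x3 - iota k * d x1 = 0.
  by rewrite -kE /e; field.
exists [:: x2; x2^-1; x3; x3^-1; x1; x1^-1], [:: 1; -1; -l; l; -k; k].
split=> //.
- rewrite /= !inE !negb_or !(inj_eq invr_inj) !VV (xVneq x2) // (xVneq x3) //.
  have x23V' : x2 != x3^-1 by rewrite -VV eq_sym.
  by rewrite x1V x23 x23V' x2_x1 x2_x1V x3_x1 x3_x1V.
- by apply/allP; rewrite /= !muV ?x1m ?x2m ?x3m.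
split; rewrite ?oner_eq0 // !big_ord_recl big_ord0 /=; first by ring.
rewrite !rmorphN rmorph1 -[RHS]dE /d; ring.
Qed.

(* Over [GF(4)] the 13th cyclotomic polynomial is the product of the two
   conjugate sextics [sextic w (w + 1)] and [sextic (w + 1) w], [w] a primitive
   cube root of unity; the six-term relation is the multiple
   [1 + (w + 1) h + w h^2] of the first one. *)
Lemma mu_dependent6_four : q = 4 -> dependent6.
Proof.
move=> q4; have [h] := mu_prim_root; have -> : muN = 13 by rewrite /muN q4.
move=> prh; have h13 := prim_expr_order prh.
have F2 : 2%:R = 0 :> F.
  by have := expf_card (-1 : F); rewrite q4 -signr_odd expr0 mulr2n
    => {1}->; rewrite addNr.
have L2 : 2%:R = 0 :> L by rewrite -(rmorph_nat iota) F2 rmorph0.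
have [w wE] : exists w : F, w ^+ 2 + w + 1 = 0.
  have : ~~ ([set: F] \subset [set 0; 1]).
    apply/negP=> /subset_leq_card; rewrite cardsT q4 cards2; by case: eqP.
  case/subsetPn=> w _; rewrite !inE negb_or => /andP[w0 w1]; exists w.
  have w1' : w - 1 != 0 by rewrite subr_eq0.
  apply: (mulfI w0); apply: (mulfI w1'); rewrite !mulr0.
  transitivity (w ^+ 4 - w); first by ring.
  by have := expf_card w; rewrite q4 => ->; rewrite subrr.
pose sextic (w w' : L) := h ^+ 6 + w * h ^+ 5 + w' * h ^+ 3 + w * h + 1.
have rel v : v ^+ 2 + v + 1 = 0 -> sextic (iota v) (iota v + 1) = 0 -> dependent6.
  move=> vE s0; have := congr1 iota vE; rewrite !rmorphD rmorphXn rmorph1 rmorph0.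
  move=> lvE; exists [:: h ^+ 0; h ^+ 1; h ^+ 2; h ^+ 4; h ^+ 5; h ^+ 8].
  exists [:: 1; 1; v + 1; v; v + 1; v]; split=> //.
  - by rewrite /= !inE !(eq_prim_root_expr prh).
  - apply/allP; rewrite /= !inE /muN q4 -!exprM !(mulnC _ 13) !(exprM h 13) h13.
    by rewrite !expr1n eqxx.
  split; rewrite ?oner_eq0 // !big_ord_recl big_ord0 /=.
    transitivity (2%:R * (2 + 2 * v)); [by ring | by rewrite F2 mul0r].
  rewrite !rmorphD rmorph1; move: (iota v) lvE s0 => u uE s0.
  (* An identity with integer coefficients, corrected by multiples of [u^2 + u + 1] and of 2, both
     of which vanish. *)
  transitivity (sextic u (u + 1) * (1 + (1 + u) * h + u * h ^+ 2)
    - (u ^+ 2 + u + 1) * (h^+2 + h ^+ 3 + h ^+ 4 + h ^+ 5 + h ^+ 6 + h ^+ 7)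
    + 2%:R * (h ^+ 2 + h ^+ 5 - u * h)); first by rewrite /sextic; ring.
  by rewrite s0 uE L2; ring.
have : sextic (iota w) (iota w + 1) * sextic (iota w + 1) (iota w) = 0.
  have := congr1 iota wE; rewrite !rmorphD rmorphXn rmorph1 rmorph0.
  move: (iota w) => u uE.
  have Phi0 : \sum_(i < 13) h ^+ i = 0.
    have h1 : h - 1 != 0.
      by rewrite subr_eq0 -(prim_order_dvd prh 1) // .
    by apply: (mulfI h1); rewrite mulr0 -subrX1 h13 subrr.
  transitivity (\sum_(i < 13) h ^+ i + (u ^+ 2 + u + 1) *
    (h ^+ 2 + 2 * h ^+ 4 + 3 * h ^+ 6 + 2 * h ^+ 8 + h ^+ 10)
    + 2%:R * (- h ^+ 2 - h ^+ 4 - h ^+ 6 - h ^+ 8 - h ^+ 10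
     + u * (h + h ^+ 3 + h ^+ 5 + h ^+ 7 + h ^+ 9 + h ^+ 11))).
    by rewrite !big_ord_recl big_ord0 /sextic /=; ring.
  by rewrite Phi0 uE L2; ring.
move/eqP; rewrite mulf_eq0 => /orP[/eqP|/eqP s0]; first exact: rel.
apply: (rel (w + 1)).
  transitivity (w ^+ 2 + w + 1 + 2%:R * (w + 1)); first by ring.
  by rewrite wE F2; ring.
rewrite rmorphD rmorph1 -[RHS]s0; congr sextic.
by rewrite -addrA -mulr2n L2 addr0.
Qed.

Lemma mu_dependent6 : (3 < q)%N -> dependent6.
Proof.
by rewrite leq_eqVlt => /orP[/eqP/esym/mu_dependent6_four | /mu_dependent6_large].
Qed.

(** * Coordinates, and the passage between [F^7] and [L] *)

Variables (e : 'I_6 -> L) (co : L -> 'I_6 -> F).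
Hypothesis e_span : forall z, z = \sum_i iota (co z i) * e i.
Hypothesis e_free : forall c : 'I_6 -> F,
  \sum_i iota (c i) * e i = 0 -> forall i, c i = 0.

Lemma tr_sum n (g : 'I_n -> L) : tr (\sum_i g i) = \sum_i tr (g i).
Proof. by rewrite /tr; do 5! rewrite ?rmorph_sum /=; rewrite -!big_split. Qed.

Lemma tr_iota c z : tr (iota c * z) = iota c * tr z.
Proof. by rewrite /tr; do 5! rewrite ?rmorphM /= ?frob_iota; ring. Qed.

Lemma tr0 : tr 0 = 0.
Proof. by have := tr_iota 0 0; rewrite rmorph0 !mul0r. Qed.

Lemma ord7P (j : 'I_7) : j = 0 \/ exists k : 'I_6, j = rshift 1 k.
Proof.
case: j => [[|j] j7]; [left | right; exists (Ordinal (j7 : (j < 6)%N))];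
  exact: val_inj.
Qed.

(** The trace lies in the image of [iota], so the default 0 is never reached. *)
Definition trF (z : L) : F := odflt 0 [pick k | iota k == tr z].

Lemma trFE z : iota (trF z) = tr z.
Proof.
rewrite /trF; case: pickP => [k /eqP //|]; have [c trc] := frob_fixedP (frob_tr z).
by move=> /(_ c); rewrite trc eqxx.
Qed.

(** These are the coordinates for the trace-dual basis of [e]; a linear functional with coefficients
    [w] then becomes multiplication by [dual w] followed by the trace. *)
Definition emb (x : L) : 'rV[F]_6 := \row_i trF (e i * x).

Definition pvec (x : L) : 'rV[F]_7 := row_mx (1 : 'rV_1) (emb x).

Lemma pvec0 x : pvec x 0 0 = 1.
Proof.
have -> : (0 : 'I_7) = lshift 6 (0 : 'I_1) by apply: val_inj.
by apply: etrans (row_mxEl _ _ 0 0) _; rewrite mxE eqxx.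
Qed.

Lemma pvecS x j : iota (pvec x 0 (rshift 1 j)) = tr (e j * x).
Proof. by rewrite -trFE; congr (iota _); apply: etrans (row_mxEr _ _ 0 j) _; rewrite mxE. Qed.

Definition dual (w : 'cV[F]_7) : L := \sum_i iota (w (rshift 1 i) 0) * e i.

Lemma pvec_dual w x : iota ((pvec x *m w) 0 0) = iota (w 0 0) + tr (dual w * x).
Proof.
rewrite mxE (@big_split_ord _ _ _ 1 6) /= big_ord1.
have -> : lshift 6 (0 : 'I_1) = 0 by apply: val_inj.
rewrite pvec0 mul1r rmorphD rmorph_sum /dual mulr_suml tr_sum; congr (_ + _).
by apply: eq_bigr => i _; rewrite rmorphM pvecS -mulrA tr_iota mulrC.
Qed.

(** Coordinate 0 gives the sum of the coefficients. The other six say that the combination in [L] is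
    trace-orthogonal to a basis, hence zero. *)
Lemma pvec_relation n (c : 'I_n -> F) (x : 'I_n -> L) :
  \sum_i c i *: pvec (x i) = 0 <->
  \sum_i c i = 0 /\ \sum_i iota (c i) * x i = 0.
Proof.
have entry j : (\sum_i c i *: pvec (x i)) 0 j = \sum_i c i * pvec (x i) 0 j.
  by rewrite summxE; apply: eq_bigr => i _; rewrite mxE.
have entry0 : (\sum_i c i *: pvec (x i)) 0 0 = \sum_i c i.
  by rewrite entry; apply: eq_bigr => i _; rewrite pvec0 mulr1.
have entryS j : iota ((\sum_i c i *: pvec (x i)) 0 (rshift 1 j))
    = tr (e j * \sum_i iota (c i) * x i).
  rewrite entry rmorph_sum mulr_sumr tr_sum; apply: eq_bigr => i _.
  by rewrite rmorphM pvecS mulrCA tr_iota.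
split=> [s0 | [c0 r0]].
  split; first by rewrite -entry0 s0 mxE.
  apply: tr_nondegenerate => w; rewrite (e_span w) mulr_suml tr_sum big1 // => j _.
  by rewrite -mulrA tr_iota -entryS s0 mxE rmorph0 mulr0.
apply/rowP=> j; rewrite [RHS]mxE; have [->|[k ->]] := ord7P j.
  by rewrite entry0.
by apply: (fmorph_inj iota); rewrite entryS r0 mulr0 tr0 rmorph0.
Qed.

Lemma pvec_inj : injective pvec.
Proof.
move=> x y xy; apply/eqP; rewrite -subr_eq0; apply/eqP/tr_nondegenerate => w.
rewrite (e_span w) mulr_suml tr_sum big1 // => j _; rewrite -mulrA tr_iota mulrBr.
have -> : e j * x - e j * y = \sum_(i < 2) iota (if i == 0 then 1 else -1)
    * (e j * if i == 0 then x else y).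
  by rewrite !big_ord_recl big_ord0 /= rmorphN rmorph1; ring.
rewrite tr_sum !big_ord_recl big_ord0 /= !tr_iota -!pvecS xy rmorphN rmorph1.
by ring.
Qed.

Lemma pvec_genmx_inj : injective (fun x => <<pvec x>>%MS).
Proof.
move=> x y /= /genmxP/andP[/sub_rVP[k xy] _]; apply: pvec_inj; rewrite xy.
have := congr1 (fun v : 'rV_7 => v 0 0) xy.
by rewrite /= [in RHS]mxE !pvec0 mulr1 => <-; rewrite scale1r.
Qed.

Definition Xmu : {set 'rV[F]_6} := emb @: mu.

Lemma card_Xmu : #|Xmu| = muN.
Proof.
rewrite card_imset ?card_mu // => x y xy; apply: pvec_inj.
by rewrite /pvec xy.
Qed.

Lemma ag_to_pgP P :
  reflect (exists2 x, x \in mu & P = <<pvec x>>%MS) (P \in ag_to_pg Xmu).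
Proof.
apply: (iffP imsetP) => [[_ /imsetP[x xm ->] ->]|[x xm ->]]; first by exists x.
by exists (emb x); rewrite ?imset_f.
Qed.

(** * Intersections of subspaces with [mu] *)

Definition mu_in (U : 'M[F]_7) : {set L} := [set x in mu | (pvec x <= U)%MS].

Lemma pts_in_mu U : pts_in (ag_to_pg Xmu) U = #|mu_in U|.
Proof.
rewrite /pts_in -(card_imset _ pvec_genmx_inj); apply: eq_card => P.
apply/setIdP/imsetP => [[/ag_to_pgP[x xm ->]] xU | [x /setIdP[xm xU] ->]].
  by exists x => //; rewrite inE xm -(genmxE (pvec x)).
by rewrite genmxE; split=> //; apply/ag_to_pgP; exists x.
Qed.

Lemma mu_in_rank4 U : \rank U = 4 -> (#|mu_in U| <= 4)%N.
Proof.
move=> rU; rewrite leqNgt; apply/negP=> /card_geqP[s [us ss sU]].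
pose M := \matrix_(i < 5) pvec s`_i.
have sm (i : 'I_5) : s`_i \in mu_in U by apply/sU/mem_nth; rewrite ss.
have MU : (M <= U)%MS.
  by apply/row_subP=> i; rewrite rowK; have /setIdP[] := sm i.
have [|u u0] := @rank_lt_relation F 5 7 M.
  by have := mxrankS MU; rewrite rU.
rewrite mulmx_sum_row; under eq_bigr do rewrite rowK.
case/pvec_relation=> c0 r0; case/eqP: u0; apply/rowP=> k; rewrite mxE.
apply: (mu_independent5 _ _ c0 r0) => [i j /eqP|i].
  by rewrite nth_uniq ?ss // => /eqP/val_inj.
by have /setIdP[] := sm i.
Qed.

(** Such a functional is constant on affine points and vanishes at one of them. *)
Lemma dual_eq0 w x : dual w = 0 -> pvec x *m w = 0 -> w = 0.
Proof.
move=> w0 xw; have := pvec_dual w x; rewrite xw w0 mul0r tr0 mxE rmorph0 addr0.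
move=> /esym/eqP; rewrite fmorph_eq0 => /eqP w00.
apply/colP=> j; rewrite [RHS]mxE; have [->//|[k ->]] := ord7P j.
exact: (e_free w0).
Qed.

(** Were the expression zero, the two duals would be proportional over [F], and [dual_eq0] would
    kill a nontrivial combination of [w1] and [w2]. The common point [x] keeps the hyperplane at
    infinity out of the pencil. *)
Lemma pencil_wronskian (w1 w2 : 'cV[F]_7) x :
  (forall a b : F, a *: w1 + b *: w2 = 0 -> a = 0 /\ b = 0) ->
  pvec x *m w1 = 0 -> pvec x *m w2 = 0 ->
  dual w1 * fr (dual w2) - dual w2 * fr (dual w1) != 0.
Proof.
move=> w12 xw1 xw2; apply/eqP=> W0.
have dualD a b : dual (a *: w1 + b *: w2) = iota a * dual w1 + iota b * dual w2.
  rewrite /dual !mulr_sumr -big_split; apply: eq_bigr => i _ /=.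
  by rewrite !mxE rmorphD !rmorphM; ring.
have indep a b : iota a * dual w1 + iota b * dual w2 = 0 -> a = 0 /\ b = 0.
  rewrite -dualD => /dual_eq0-/(_ x) d0; apply: w12; apply: d0.
  by rewrite mulmxDr -!scalemxAr xw1 xw2 !scaler0 addr0.
have [w20|w20] := eqVneq (dual w2) 0.
  have [] := indep 0 1; first by rewrite w20 rmorph0; ring.
  by move=> _ /eqP; rewrite oner_eq0.
have [k kE] : exists k, dual w1 / dual w2 = iota k.
  apply: frob_fixedP; have f20 : fr (dual w2) != 0 by rewrite fmorph_eq0.
  rewrite fmorph_div /=; apply: (mulIf f20); rewrite divfK //; apply: (mulIf w20).
  have /eqP := W0; rewrite subr_eq0 => /eqP W1.
  by rewrite mulrC -W1; field.
have [] := indep 1 (- k); last by move/eqP; rewrite oner_eq0.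
by rewrite rmorph1 rmorphN -kE; field.
Qed.

Lemma mu_in_rank5 U : \rank U = 5 -> (#|mu_in U| <= 6)%N.
Proof.
move=> rU; have [->|/set0Pn[x0 /setIdP[_ x0U]]] := eqVneq (mu_in U) set0.
  by rewrite cards0.
have [w1 [w2 [wU w12]]] := codim2_functionals rU.
have [x0w1 x0w2] := (wU _).1 x0U.
apply: leq_trans (mu_pencil_bound (w1 0 0) (w2 0 0)
  (pencil_wronskian w12 x0w1 x0w2)).
apply: subset_leq_card; apply/subsetP=> x /setIdP[xm /wU[xw1 xw2]].
by rewrite in_set xm -!pvec_dual xw1 xw2 mxE rmorph0 eqxx.
Qed.

(* If a functional vanishes on [mu], so does its translate by [z]; together they
   contradict the bound on pencils. *)
Lemma mu_span (U : 'M[F]_7) : (3 < q)%N ->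
  (forall x, x \in mu -> (pvec x <= U)%MS) -> \rank U = 7.
Proof.
move=> q3 muU; apply/eqP; apply: contraT => rU.
have [w w0 Uw] : exists2 w : 'cV[F]_7, w != 0 & U *m w = 0.
  have : cokermx U != 0 by rewrite -mxrank_eq0 mxrank_coker; have := rank_leq_col U; lia.
  rewrite -(inj_eq trmx_inj) trmx0 => /rowV0Pn[v /submxP[D vE] v0].
  exists v^T; first by rewrite -(inj_eq trmx_inj) trmxK trmx0.
  by rewrite vE trmx_mul trmxK mulmxA mulmx_coker mul0mx.
have xw x : x \in mu -> pvec x *m w = 0.
  by move=> /muU/submxP[D ->]; rewrite -mulmxA Uw mulmx0.
have a0 : dual w != 0.
  by apply: contra w0 => /eqP w0; rewrite (dual_eq0 w0 (xw 1 mu1)).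
have [z zm z1] := exists_mu_neq1.
have W0 : dual w * fr (dual w * z) - dual w * z * fr (dual w) != 0.
  rewrite rmorphM /=.
  have -> : dual w * (fr (dual w) * fr z) - dual w * z * fr (dual w)
      = dual w * fr (dual w) * (fr z - z) by ring.
  rewrite !mulf_neq0 ?fmorph_eq0 // subr_eq0; apply: contra z1 => /eqP zq.
  by rewrite (mu_frob_id zm zq).
have := mu_pencil_bound (w 0 0) (w 0 0) W0; rewrite leqNgt.
case/negP; apply: (@leq_trans #|mu|); first by rewrite card_mu /muN; nia.
apply: subset_leq_card; apply/subsetP=> x xm.
by rewrite in_set xm -mulrA -!pvec_dual !xw ?muM // mxE rmorph0 eqxx.
Qed.

Lemma six_in_rank5 : (3 < q)%N ->
  exists2 U : 'M[F]_7, \rank U = 5 & (6 <= #|mu_in U|)%N.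
Proof.
move=> q3; have [s [c [ss us smu [c0 c1 r1]]]] := mu_dependent6 q3.
pose M := \matrix_(i < 6) pvec s`_i.
have [||U rU MU] := @submx_extend_rank F 6 7 M 5 => //.
  rewrite -ltnS; apply: (@relation_rank_lt F 6 7 M (\row_i c`_i)).
    by apply: contra c0 => /eqP/rowP/(_ 0); rewrite !mxE => ->.
  rewrite mulmx_sum_row -[RHS]((pvec_relation _ _).2 (conj c1 r1)).
  by apply: eq_bigr => i _; rewrite rowK mxE.
exists U => //; suff: (size s <= size (enum (mu_in U)))%N by rewrite ss -cardE.
apply: uniq_leq_size => // x xs; rewrite mem_enum in_set smu //=; apply: submx_trans MU.
have xi : (index x s < 6)%N by have := index_mem x s; rewrite xs ss.
by rewrite -(nth_index 0 xs) -(rowK (fun i : 'I_6 => pvec s`_i) (Ordinal xi)) row_sub.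
Qed.

(** The pencil through [U] has [q + 1] hyperplanes, and at least [q^2 - q - 5 > q + 1] points of
    [mu] lie off [U]. Hence two of these share a hyperplane with the six on [U]. *)
Lemma eight_in_rank6 : (3 < q)%N ->
  exists2 U : 'M[F]_7, \rank U = 6 & (8 <= #|mu_in U|)%N.
Proof.
move=> q3; have [U rU U6] := six_in_rank5 q3.
have [w1 [w2 [wU w12]]] := codim2_functionals rU.
pose f x : F := (pvec x *m w1) 0 0; pose g x : F := (pvec x *m w2) 0 0.
(* [rho x] labels the hyperplane of the pencil through [x]; [option F] is the projective line with
   [None] at infinity. *)
pose rho x : option F := if g x == 0 then None else Some (f x / g x).
pose O := mu :\: mu_in U.
have cO : (#|{: option F}| < #|O|)%N.
  rewrite card_option cardsD card_mu (setIidPr _); last first.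
    by apply/subsetP=> x /setIdP[].
  have := mu_in_rank5 rU; rewrite /muN.
  move: #|mu_in U| #|F| q3 => m k k3 m6; nia.
have : ~~ dinjectiveb rho (mem O).
  apply/negP=> /dinjectiveP/card_in_imset rO.
  by move: cO; rewrite -rO ltnNge max_card.
case/dinjectivePn=> x xO [y /andP[yx yO] xy].
have [c [d [cd0 cx cy]]] : exists c d : F,
    [/\ (c, d) <> (0, 0), c * f x + d * g x = 0 & c * f y + d * g y = 0].
  move: xy; rewrite /rho; case: eqVneq => [gx|gx]; case: eqVneq => [gy|gy] //.
    by exists 0, 1; rewrite gx gy; split=> [[/eqP]||]; rewrite ?oner_eq0 //; ring.
  case=> fE; exists 1, (- (f x / g x)); split=> [[/eqP]||]; rewrite ?oner_eq0 //.
    by field.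
  by rewrite fE; field.
pose w := c *: w1 + d *: w2.
have w0 : w != 0 by apply/eqP=> /w12[c0 d0]; apply: cd0; rewrite c0 d0.
have M0 (A : 'M[F]_1) : A 0 0 = 0 -> A = 0.
  by move=> A0; apply/matrixP=> i j; rewrite !ord1 A0 mxE.
have kw z : c * f z + d * g z = 0 -> (pvec z <= kermx w)%MS.
  move=> z0; apply/sub_kermxP/M0; rewrite -[RHS]z0 mulmxDr -!scalemxAr [LHS]mxE.
  by congr (_ + _); rewrite [LHS]mxE.
exists (kermx w).
  rewrite mxrank_ker; have := rank_leq_col w; rewrite -mxrank_eq0 in w0.
  by move: w0; case: (\rank w) => [|[|]].
have xU : x \notin mu_in U by case/setDP: xO.
have yU : y \notin x |: mu_in U.
  by rewrite in_setU1 negb_or yx; case/setDP: yO.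
apply: (@leq_trans #|y |: (x |: mu_in U)|).
  by rewrite !cardsU1 xU yU.
apply: subset_leq_card; apply/subsetP=> z; rewrite !in_setU1.
case/or3P=> [/eqP->|/eqP->|/setIdP[zm /wU[z1 z2]]]; apply/setIdP; split=> //.
- by case/setDP: yO.
- exact: kw.
- by case/setDP: xO.
- exact: kw.
by apply: kw; rewrite /f /g z1 z2 !mxE !mulr0 addr0.
Qed.

(** * The action of [mu] by multiplication *)

(** This is the transpose of multiplication by [z] on row vectors in the basis [e], because [emb]
    uses the dual basis. *)
Definition mulmat (z : L) : 'M[F]_6 := \matrix_(i, j) co (e j * z) i.

Definition projmat (z : L) : 'M[F]_7 := block_mx (1 : 'M_1) 0 0 (mulmat z).

Lemma emb_mul x z : emb x *m mulmat z = emb (z * x).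
Proof.
apply/rowP=> j; apply: (fmorph_inj iota); rewrite !mxE trFE rmorph_sum.
rewrite mulrA (e_span (e j * z)) mulr_suml tr_sum; apply: eq_bigr => i _.
by rewrite !mxE rmorphM /= trFE -mulrA tr_iota mulrC.
Qed.

Lemma pvec_mul x z : pvec x *m projmat z = pvec (z * x).
Proof.
apply: etrans (@mul_row_block F 1 1 6 1 6 1 (emb x) 1 0 0 (mulmat z)) _.
by rewrite mulmx1 !mulmx0 emb_mul addr0 add0r.
Qed.

(** The row space contains each [pvec x], the image of [pvec (z^-1 * x)], and these span by
    [mu_span]. *)
Lemma projmat_unit z : (3 < q)%N -> z \in mu -> projmat z \in unitmx.
Proof.
move=> q3 zm; rewrite -row_full_unit; apply/eqP/mu_span => // x xm.
by rewrite -[x](mulVKf (mu_neq0 zm)) -pvec_mul submxMl.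
Qed.

Lemma sub_HinfP (v : 'rV[F]_7) : (v <= Hinf F 6)%MS = (v 0 0 == 0).
Proof.
apply/idP/eqP=> [/submxP[D ->] | v0].
  by rewrite mxE big1 // => i _; rewrite mxE andbN mulr0.
apply/submxP; exists v; apply/rowP=> j; rewrite mxE (bigD1 j) //= big1 => [|i ij].
  by rewrite mxE eqxx /= addr0; case: eqVneq => [->|]; rewrite ?mulr1 // v0 mul0r.
by rewrite mxE (negPf ij) mulr0.
Qed.

Lemma projmat_Hinf z : (3 < q)%N -> z \in mu ->
  (Hinf F 6 *m projmat z == Hinf F 6)%MS.
Proof.
move=> q3 zm; have Mu := projmat_unit q3 zm.
have sH : (Hinf F 6 *m projmat z <= Hinf F 6)%MS.
  apply/row_subP=> i; rewrite sub_HinfP mxE mxE big1 // => k _.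
  have [k0|[j ->]] := ord7P k; first by rewrite k0 mxE andbN mul0r.
  suff -> : projmat z (rshift 1 j) 0 = 0 by rewrite mulr0.
  have -> : (0 : 'I_7) = lshift 6 (0 : 'I_1) by apply: val_inj.
  by apply: etrans (block_mxEdl _ _ _ _ j 0) _; rewrite mxE.
(* An invertible matrix preserves rank, so the inclusion is an equality. *)
by rewrite -(mxrank_leqif_eq sH) mxrankMfree // row_free_unit.
Qed.

Lemma Xmu_transitive : (3 < q)%N -> transitive_set (ag_to_pg Xmu).
Proof.
move=> q3 _ _ /ag_to_pgP[x xm ->] /ag_to_pgP[y ym ->].
pose z : L := y / x; have zm : z \in mu by rewrite muM ?muV.
have actE t : proj_act (projmat z) <<pvec t>>%MS = <<pvec (z * t)%R>>%MS.
  by rewrite /proj_act -pvec_mul; apply/eq_genmx/eqmxMr/genmxE.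
exists (projmat z); split; last by rewrite actE divfK ?mu_neq0.
split; [exact: projmat_unit | apply/setP=> P | exact: projmat_Hinf].
apply/imsetP/idP=> [[_ /ag_to_pgP[t tm ->] ->] | /ag_to_pgP[t tm ->]].
  by apply/ag_to_pgP; exists (z * t); [exact: muM | exact: actE].
exists <<pvec (z^-1 * t)%R>>%MS; last by rewrite actE mulVKf ?mu_neq0.
by apply/ag_to_pgP; exists (z^-1 * t) => //; rewrite muM ?muV.
Qed.

Lemma Xmu_spans (U : 'M[F]_7) : (3 < q)%N ->
  (forall P, P \in ag_to_pg Xmu -> (P <= U)%MS) -> \rank U = 7.
Proof.
move=> q3 XU; apply: mu_span => // x xm; rewrite -(genmxE (pvec x)).
by apply: XU; apply/ag_to_pgP; exists x.
Qed.

Lemma Xmu_properties : (3 < q)%N ->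
  #|Xmu| = (q ^ 2 - q + 1)%N /\ k_general 5 (ag_to_pg Xmu) /\
  rs_set 6 4 (ag_to_pg Xmu) /\ transitive_set (ag_to_pg Xmu).
Proof.
move=> q3; split; first exact: card_Xmu.
split; [|split; last exact: Xmu_transitive]; split=> [U rU|U|].
- by rewrite pts_in_mu mu_in_rank4.
- exact: Xmu_spans.
- by have [U rU cU] := six_in_rank5 q3; exists U; rewrite pts_in_mu.
- by rewrite pts_in_mu mu_in_rank5.
- exact: Xmu_spans.
by have [U rU cU] := eight_in_rank6 q3; exists U; rewrite pts_in_mu.
Qed.

End NormOneGroup.

Theorem mainTheorem13 (F : finFieldType) :
  (4 <= #|F|)%N ->
  exists X : {set 'rV[F]_6},
    #|X| = (#|F| ^ 2 - #|F| + 1)%N /\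
    k_general 5 (ag_to_pg X) /\
    rs_set 6 4 (ag_to_pg X) /\
    transitive_set (ag_to_pg X).
Proof.
move=> q4; have [L dL] := @finField_extension_exists F 6 isT.
have [e [co [e_span e_free]]] := fieldExt_coordinates dL.
have cardL : #|finvect_type L| = (#|F| ^ 6)%N.
  by rewrite -(card_vspacef (Vector.class (finvect_type L))) card_vspace -dL.
pose iota : {rmorphism F -> finvect_type L} := GRing.in_alg (finvect_type L).
exists (Xmu iota e).
exact: (@Xmu_properties F (finvect_type L) iota cardL e co e_span e_free q4).
Qed.
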